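(* For every $n\ge 1$, $$|\mathfrak{S}_n(132,\mathrm{D}_4)|=C_{n-1}+\frac{(n-1)(2n^2-7n+12)}{6}.$$
   Context: $C_n=\frac{1}{n+1}\binom{2n}{n}$ is the $n$-th Catalan number. $\mathfrak{S}_n$ is the set of permutations $\sigma=\sigma_1\sigma_2\cdots\sigma_n$ of $[n]=\{1,\dots,n\}$ in one-line notation. A mesh pattern is a pair $p=(\pi,R)$ with $\pi\in\mathfrak{S}_m$ and $R\subseteq\{0,\dots,m\}\times\{0,\dots,m\}$ (the set of shaded unit cells, each given by its bottom-left corner, in the grid with dots at $(i,\pi_i)$). An occurrence of $p$ in $\sigma\in\mathfrak{S}_n$ is a choice of indices $i_1<\cdots<i_m$ such that $\sigma_{i_1}\cdots\sigma_{i_m}$ is order-isomorphic to $\pi$ and, for every $(a,b)\in R$, there is no index $r$ with $i_a<r<i_{a+1}$ and $v_b<\sigma_r<v_{b+1}$; here $v_1<\cdots<v_m$ is the increasing rearrangement of $\sigma_{i_1},\dots,\sigma_{i_m}$, $i_0=v_0=0$ and $i_{m+1}=v_{m+1}=n+1$. A classical pattern $\pi$ is the mesh pattern $(\pi,\varnothing)$. $\mathfrak{S}_n(p,q)$ is the set of permutations in $\mathfrak{S}_n$ with no occurrence of $p$ and no occurrence of $q$. Here $132$ is the classical pattern and $\mathrm{D}_4=(4321,\{(0,0),(4,4)\})$. *)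

(* Defs.v *)
From mathcomp Require Import all_boot all_fingroup all_algebra.

Set Implicit Arguments.
Unset Strict Implicit.
Unset Printing Implicit Defensive.

Import GRing.Theory.

(* Positions and values are 0-based in 'S_n, whereas the grid lines 0, ..., m+1
   of a mesh pattern are numbered as for permutations of {1, ..., n}; hence the
   successors in [pos_lines], [val_lines] and [mesh_occ]. *)

Record mesh_pattern (m : nat) := MeshPattern {
  mesh_perm : 'S_m;
  mesh_shading : {set 'I_m.+1 * 'I_m.+1}
}.

Definition classical_pattern m (pi : 'S_m) : mesh_pattern m :=
  MeshPattern pi set0.

Section Occurrences.
Variables (m n : nat).
Implicit Types (p : mesh_pattern m) (s : 'S_n) (i : {ffun 'I_m -> 'I_n}).

(* [:: i_0; i_1; ...; i_m; i_{m+1}] with i_0 = 0 and i_{m+1} = n + 1. *)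
Definition pos_lines i : seq nat :=
  0 :: rcons [seq (val (i k)).+1 | k <- enum 'I_m] n.+1.

(* [:: v_0; v_1; ...; v_m; v_{m+1}] with v_0 = 0 and v_{m+1} = n + 1. *)
Definition val_lines s i : seq nat :=
  0 :: rcons (sort leq [seq (val (s (i k))).+1 | k <- enum 'I_m]) n.+1.

Definition mesh_occ p s i : bool :=
  [&& [forall j : 'I_m, forall k : 'I_m, (j < k) ==> (i j < i k)],
      [forall j : 'I_m, forall k : 'I_m,
         (s (i j) < s (i k)) == (mesh_perm p j < mesh_perm p k)]
    & [forall c in mesh_shading p, ~~ [exists r : 'I_n,
         (nth 0 (pos_lines i) c.1 < r.+1 < nth 0 (pos_lines i) c.1.+1)
         && (nth 0 (val_lines s i) c.2 < (s r).+1
               < nth 0 (val_lines s i) c.2.+1)]]].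

Definition mesh_avoids p s : bool := ~~ [exists i, mesh_occ p s i].

End Occurrences.

Definition avoiders2 n m1 m2 (p : mesh_pattern m1) (q : mesh_pattern m2) :
    {set 'S_n} :=
  [set s : 'S_n | mesh_avoids p s && mesh_avoids q s].

Definition perm132 : 'S_3 := tperm (inord 1) (inord 2).
Definition perm4321 : 'S_4 := perm (@rev_ord_inj 4).

Lemma perm132_one_line :
  [seq (val (perm132 k)).+1 | k <- enum 'I_3] = [:: 1; 3; 2].
Proof.
rewrite -[RHS](map_id) -(@eq_map _ _ (fun k : 'I_3 => nth 0 [:: 1; 3; 2] k)).
  by rewrite (map_comp (nth 0 [:: 1; 3; 2]) val) val_enum_ord.
move=> k; rewrite /perm132 permE /= -!val_eqE /= !inordK //.
by case: k => [[|[|[|k]]] hk] //=; rewrite inordK.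
Qed.

Lemma perm4321_one_line :
  [seq (val (perm4321 k)).+1 | k <- enum 'I_4] = [:: 4; 3; 2; 1].
Proof.
rewrite (@eq_map _ _ _ ((fun k => (4 - k.+1).+1) \o val)) => [|k].
  by rewrite map_comp val_enum_ord.
by rewrite /perm4321 permE.
Qed.

Definition p132 : mesh_pattern 3 := classical_pattern perm132.

Definition D4 : mesh_pattern 4 :=
  MeshPattern perm4321 [set (ord0, ord0); (ord_max, ord_max)].

Definition catalan (n : nat) : rat := ('C(2 * n, n)%:R / n.+1%:R)%R.

(* Main.v *)
Require Import Defs.
From mathcomp Require Import all_boot all_fingroup all_algebra.
From mathcomp Require Import zify ring.

(** A permutation is handled through its one-line word, a sequence of naturals,
    and a pattern occurrence through the subsequence of letters that it selects.

    A 132-avoiding word with largest letter N is L' N R, where every letter of L'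
    exceeds every letter of R and where L' and R avoid 132; this is [splice],
    and [words132S] says that it is a bijection.  Write ldec for [longest_dec], the
    length of a longest decreasing subsequence.  Since L' lies above R, and N may
    serve only when nothing of L' is used, the word L' N R has ldec equal to max(1, ldec L) + ldec R ([longest_dec_splice]).

    The shaded corner (0, 0) is automatically empty in a 132-avoiding word: a
    letter left of and below a decreasing subsequence forms 132 with its first
    two letters.  The corner (4, 4) is empty unless some later letter exceeds the
    first letter of the occurrence.  If R is empty, then N is such a letter for
    every decreasing subsequence of length 4.  If R is not empty and the whole
    word has a decreasing subsequence of length 4, then there is one that starts
    at or before N and ends in R, and nothing after it can exceed its first
    letter.  Hence the word avoids D4 iff R is empty or
    max(1, ldec L) + ldec R <= 3 ([avD4_splice]).

    It remains to count.  The number of words is a Catalan number: the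
    convolution recurrence is matched with the closed form by an explicit
    telescoping sum ([sum_catalan]).  The recursion for ldec gives one word of
    each length with ldec <= 1 and C(n, 2) + 1 words with ldec <= 2.  For nonempty
    R the condition above says that (ldec L, ldec R) is at most (2, 1) or at most
    (1, 2), so inclusion-exclusion gives C(k, 2) + C(n - k, 2) + 1 pairs with
    |L| = k and |L| + |R| = n.  Summing over k < n yields the cubic term; empty R
    contributes the Catalan number ([count_avD4]). *)

Set Implicit Arguments.
Unset Strict Implicit.
Unset Printing Implicit Defensive.

(** * Patterns in words *)

Definition has_subseq (P : pred (seq nat)) (w : seq nat) : bool :=
  [exists m : (size w).-tuple bool, P (mask m w)].

Lemma has_subseqP (P : pred (seq nat)) (w : seq nat) :
  reflect (exists2 t, subseq t w & P t) (has_subseq P w).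
Proof.
apply: (iffP existsP) => [[m Pm] | [t /subseqP[m sz_m ->] Pt]].
  by exists (mask m w) => //; apply: mask_subseq.
by have /eqP sz := sz_m; exists (Tuple sz).
Qed.

Definition is132 (t : seq nat) : bool :=
  if t is [:: a; c; b] then a < b < c else false.

Definition av132 (w : seq nat) : bool := ~~ has_subseq is132 w.

(** In a word without repeated letters, the letters that occur before all of [t]
    are the [y] such that [y :: t] is a subsequence, and dually for [rcons t y];
    so the two shaded corners can be stated without positions.  The default 0 of
    [last] and [head] is never reached, as [t] has four letters. *)
Definition occD4 (w t : seq nat) : bool :=
  [&& size t == 4, pairwise gtn t,
      ~~ has (fun y => (y < last 0 t) && subseq (y :: t) w) w
    & ~~ has (fun y => (head 0 t < y) && subseq (rcons t y) w) w].

Definition avD4 (w : seq nat) : bool := ~~ has_subseq (occD4 w) w.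

Definition longest_dec (w : seq nat) : nat :=
  \max_(m : (size w).-tuple bool | pairwise gtn (mask m w)) size (mask m w).

Lemma longest_dec_geP (j : nat) (w : seq nat) :
  reflect (exists t, [/\ subseq t w, pairwise gtn t & size t = j])
          (j <= longest_dec w).
Proof.
apply: (iffP idP) => [le_j | [t [/subseqP[m sz_m ->] dec_t <-]]]; last first.
  have /eqP sz := sz_m.
  exact: (@leq_bigmax_cond _ _ (fun m : (size w).-tuple bool =>
             size (mask m w)) (Tuple sz)).
have [m dec_m def_l]: {m : (size w).-tuple bool |
    pairwise gtn (mask m w) & longest_dec w = size (mask m w)}.
  apply: eq_bigmax_cond; apply/card_gt0P.
  by exists [tuple of nseq (size w) false]; rewrite unfold_in /= mask_false.
exists (take j (mask m w)); split.
- exact: subseq_trans (take_subseq _ _) (mask_subseq _ _).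
- exact: subseq_pairwise (take_subseq _ _) dec_m.
- by rewrite size_takel // -def_l.
Qed.

Lemma subseq_catP (t s1 s2 : seq nat) :
  reflect (exists t1 t2, [/\ t = t1 ++ t2, subseq t1 s1 & subseq t2 s2])
          (subseq t (s1 ++ s2)).
Proof.
apply: (iffP idP) => [/subseqP[m sz_m ->] | [t1 [t2 [-> ? ?]]]]; last first.
  exact: cat_subseq.
rewrite -(cat_take_drop (size s1) m) mask_cat.
  by do 2!eexists; split; first reflexivity; apply: mask_subseq.
by rewrite size_takel // sz_m size_cat leq_addr.
Qed.

Lemma longest_dec_nil : longest_dec [::] = 0.
Proof. by apply/eqP; rewrite -leqn0 leqNgt; apply/longest_dec_geP => -[[|? ?] []]. Qed.

Lemma longest_dec_gt0 (w : seq nat) : w != [::] -> 0 < longest_dec w.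
Proof.
case: w => // x w _; apply/longest_dec_geP; exists [:: x]; split=> //.
by rewrite sub1seq mem_head.
Qed.

(** L shifted above R, followed by a new maximum, followed by R: the general form
    of a 132-avoiding word whose letters are 0, ..., N. *)
Definition splice (L R : seq nat) : seq nat :=
  map (addn (size R)) L ++ (size L + size R) :: R.

Section Splice.
Variables L R : seq nat.
Hypotheses (permL : perm_eq L (iota 0 (size L))).
Hypotheses (permR : perm_eq R (iota 0 (size R))).
Let N := size L + size R.
Let L' := map (addn (size R)) L.

Lemma splice_high x : x \in L' -> size R <= x < N.
Proof.
case/mapP => y; rewrite (perm_mem permL) mem_iota /= => lt_y ->.
by rewrite leq_addr /N addnC ltn_add2r.
Qed.

Lemma splice_low x : x \in R -> x < size R.
Proof. by rewrite (perm_mem permR) mem_iota. Qed.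

Lemma is132_map m t : is132 (map (addn m) t) = is132 t.
Proof. by case: t => [|a [|c [|b [|? ?]]]] //=; rewrite !ltn_add2l. Qed.

Lemma subseq_map_addn m t s :
  subseq t (map (addn m) s) -> exists2 t', subseq t' s & t = map (addn m) t'.
Proof.
case/subseqP=> k sz_k ->; exists (mask k s); first exact: mask_subseq.
by rewrite map_mask.
Qed.

(** An occurrence of 132 cannot straddle the maximum: a letter before it exceeds
    every letter after it, so the last letter of the occurrence would be smaller
    than the first, and the maximum itself can only play the role of 3. *)
Lemma av132_splice : av132 (splice L R) = av132 L && av132 R.
Proof.
rewrite /av132 -negb_or; congr (~~ _); apply/has_subseqP/orP; last first.
  case=> /has_subseqP[t sub_t t132].
    exists (map (addn (size R)) t); last by rewrite is132_map.
    exact: subseq_trans (map_subseq _ sub_t) (prefix_subseq _ _).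
  exists t => //; apply: subseq_trans sub_t _.
  exact: subseq_trans (subseq_cons _ _) (suffix_subseq _ _).
case=> _ /subseq_catP[t1 [t2 [-> sub1 sub2]]] t132.
have hi x : x \in t1 -> size R <= x < N.
  by move/(mem_subseq sub1); apply: splice_high.
have lo x : x \in t2 -> x = N \/ x < size R.
  move/(mem_subseq sub2); rewrite inE => /orP[/eqP|/splice_low]; first by left.
  by right.
have tl t : subseq t R -> {subset t <= R} by apply: mem_subseq.
case: t1 sub1 hi t132 => [|a [|c [|b [|? ?]]]] //= sub1 hi t132.
- right; apply/has_subseqP.
  case: t2 sub2 lo t132 => [|a [|c [|b [|? ?]]]] //= sub2 lo /andP[ab bc].
  move: sub2; case: eqP => [a_N sub2|_ sub2]; last first.
    by exists [:: a; c; b]; rewrite //= ab.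
  have bR: b \in R by apply: tl sub2 _ _; rewrite !inE eqxx orbT.
  by have := splice_low bR; rewrite /N in a_N; lia.
- case: t2 sub2 lo t132 => [|c [|b [|? ?]]] //= sub2 lo /andP[ab bc].
  have /andP[le_a _]: size R <= a < N by apply: hi; rewrite mem_head.
  have bR: b \in R.
    move: sub2; case: eqP => _ sub2; apply: tl sub2 _ _; rewrite !inE eqxx //.
    by rewrite orbT.
  by have := splice_low bR; lia.
- case: t2 sub2 lo t132 => [|b [|? ?]] //= sub2 lo /andP[ab bc].
  have /andP[le_a _]: size R <= a < N by apply: hi; rewrite mem_head.
  have /andP[_ lt_c]: size R <= c < N by apply: hi; rewrite !inE eqxx orbT.
  by have := lo b; rewrite inE eqxx => /(_ isT)[]; lia.
- left; apply/has_subseqP; case: t2 {sub2 lo} t132 => // t132.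
  have [t sub_t def_t] := subseq_map_addn sub1.
  by exists t => //; rewrite -(is132_map (size R)) -def_t.
Qed.

Lemma pairwise_gtn_map m t : pairwise gtn (map (addn m) t) = pairwise gtn t.
Proof. by rewrite pairwise_map; apply: eq_pairwise => x y /=; rewrite ltn_add2l. Qed.

Lemma dec_below_max t : {in t, forall x, x < N} -> pairwise gtn t ->
  pairwise gtn (N :: t).
Proof. by move=> lt_t dec_t; rewrite /= dec_t andbT; apply/allP. Qed.

(** The prefix ending at the maximum contributes at least one letter even if L is
    empty, and any decreasing choice there lies above any choice in R. *)
Lemma longest_dec_splice_witness : exists t1 t2,
  [/\ subseq t1 (L' ++ [:: N]), subseq t2 R, pairwise gtn (t1 ++ t2),
      size t1 = maxn 1 (longest_dec L) & size t2 = longest_dec R].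
Proof.
have /longest_dec_geP[t2 [sub2 dec2 sz2]] := leqnn (longest_dec R).
have /longest_dec_geP[t [sub_t dec_t sz_t]] := leqnn (longest_dec L).
have lo y : y \in t2 -> y < size R by move/(mem_subseq sub2)/splice_low.
case: (posnP (longest_dec L)) => [L0 | L_gt0].
  exists [:: N], t2; rewrite L0; split=> //; first exact: suffix_subseq.
  by apply: dec_below_max => // y /lo; rewrite /N; lia.
exists (map (addn (size R)) t), t2; split=> //.
- exact: subseq_trans (map_subseq _ sub_t) (prefix_subseq _ _).
- rewrite pairwise_cat pairwise_gtn_map dec_t dec2 !andbT.
  by apply/allrelP => x y /mapP[z _ ->] /lo /=; lia.
- by rewrite size_map sz_t; lia.
Qed.

(** For the upper bound, a decreasing subsequence using the maximum must start with
    it and then continues in R only. *)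
Lemma longest_dec_splice :
  longest_dec (splice L R) = maxn 1 (longest_dec L) + longest_dec R.
Proof.
apply/eqP; rewrite eqn_leq; apply/andP; split; last first.
  have [t1 [t2 [sub1 sub2 dec sz1 sz2]]] := longest_dec_splice_witness.
  apply/longest_dec_geP; exists (t1 ++ t2); rewrite size_cat sz1 sz2; split=> //.
  by rewrite /splice -(cat1s N) catA; apply: cat_subseq.
have /longest_dec_geP[t [sub_t dec_t <-]] := leqnn (longest_dec (splice L R)).
case/subseq_catP: sub_t dec_t => [t1 [t2 [-> sub1 sub2]]].
rewrite pairwise_cat size_cat => /and3P[dec12 dec1 dec2].
have le1: size t1 <= longest_dec L.
  have [t' sub' def_t] := subseq_map_addn sub1.
  apply/longest_dec_geP; exists t'; rewrite def_t size_map; split=> //.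
  by rewrite def_t pairwise_gtn_map in dec1.
case: t2 sub2 dec12 dec2 => [|y t2] /= sub2 dec12; first by lia.
case/andP=> dec_y dec2; move: sub2; case: eqP => [y_N sub2 | _ sub2].
  have: size t2 <= longest_dec R by apply/longest_dec_geP; exists t2.
  case: t1 sub1 dec12 {dec1 le1} => [|x t1] sub1 dec12 /=; first by lia.
  have /andP[_] : size R <= x < N.
    by apply/splice_high/(mem_subseq sub1)/mem_head.
  by move: dec12 => /= /andP[/andP[/= ? _] _]; rewrite /N in y_N *; lia.
have: (size t2).+1 <= longest_dec R.
  by apply/longest_dec_geP; exists (y :: t2); split; rewrite //= dec_y.
by rewrite addnS -ltnS; lia.
Qed.

(** If R is empty, the maximum comes after, and exceeds, every letter of a
    decreasing subsequence of length 4, so the corner (4, 4) is never empty.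
    Otherwise take any four letters of a longest decreasing subsequence that
    include its first letter d and its last one: what follows the last letter
    lies in R, hence below d. *)
Lemma avD4_splice : av132 (splice L R) ->
  avD4 (splice L R) = (R == [::]) || (maxn 1 (longest_dec L) + longest_dec R <= 3).
Proof.
move=> av; rewrite -longest_dec_splice; have [R0 | R_neq0] := eqVneq R [::].
  suff: avD4 (splice L R) by move->.
  rewrite /avD4; apply/negP => /has_subseqP[t sub_t /and4P[/eqP sz_t dec_t _ /hasP[]]].
  exists N; first by rewrite mem_cat mem_head orbT.
  have def_w: splice L R = L' ++ [:: N] by rewrite /L' /N /splice R0.
  move: sub_t; rewrite def_w => /subseq_catP[t1 [t2 [def_t sub1 sub2]]].
  suff t2_0: t2 = [::].
    rewrite def_t t2_0 cats0 -cats1 subseq_cat2r sub1 andbT.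
    move: sz_t sub1; rewrite def_t t2_0 cats0; case: (t1) => //= x s _ sub1.
    by have /andP[] := splice_high (mem_subseq sub1 (mem_head _ _)).
  have sz2 := size_subseq sub2; case: t1 => [|x t1] in def_t sub1 *.
    by rewrite def_t /= in sz_t; rewrite sz_t in sz2.
  case: t2 => // y t2 in def_t sub2 {sz2} *.
  have y_N: y = N by apply/eqP; have := mem_subseq sub2 (mem_head _ _); rewrite inE.
  have /andP[_] : size R <= x < N by apply/splice_high/(mem_subseq sub1)/mem_head.
  move: dec_t; rewrite def_t pairwise_cat => /and3P[/allrelP dec _ _].
  by have /= := dec x y (mem_head _ _) (mem_head _ _); rewrite y_N; lia.
rewrite orFb; apply/idP/idP => [|le3]; last first.
  rewrite /avD4; apply/negP => /has_subseqP[t sub_t /and4P[/eqP sz_t dec_t _ _]].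
  have /longest_dec_geP: exists t, [/\ subseq t (splice L R), pairwise gtn t & size t = 4].
    by exists t.
  by rewrite ltnNge le3.
apply: contraLR; rewrite -ltnNge longest_dec_splice => ge4; rewrite /avD4 negbK.
have [t1 [t2 [sub1 sub2 dec sz1 sz2]]] := longest_dec_splice_witness.
have := longest_dec_gt0 R_neq0; rewrite -sz2.
case/lastP: t2 => // t2 a in sub2 dec sz2 * => _.
case: t1 => [|d t1] in sub1 dec sz1 *; first by move: sz1 => /=; lia.
(* The occurrence is d, then any two letters strictly between d and a in the
   longest decreasing subsequence, then a. *)
have aR: a \in R by apply: (mem_subseq sub2); rewrite mem_rcons mem_head.
pose u := take 2 (t1 ++ t2).
have sz_u: size u = 2.
  by rewrite size_takel // size_cat; move: sz1 sz2; rewrite size_rcons /=; lia.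
have sub_u: subseq (d :: rcons u a) ((d :: t1) ++ rcons t2 a).
  rewrite /= eqxx -cats1 -[rcons t2 a]cats1 catA.
  by apply: cat_subseq => //; apply: take_subseq.
have sub_w: subseq ((d :: t1) ++ rcons t2 a) (splice L R).
  by rewrite /splice -(cat1s N) catA; apply: cat_subseq.
have dec_u := subseq_pairwise sub_u dec.
apply/has_subseqP; exists (d :: rcons u a); first exact: subseq_trans sub_w.
apply/and4P; split.
- by rewrite /= size_rcons sz_u.
- exact: dec_u.
- (* A letter y below and before all of d c b a makes y d c an instance of 132. *)
  apply/hasP => -[y _ /andP[]]; rewrite /= last_rcons => lt_ya sub_y.
  rewrite /av132 in av; case/negP: av; apply/has_subseqP.
  case def_u: u sz_u => [|c [|b [|? ?]]] // _ in sub_y *.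
  exists [:: y; d; c].
    by apply: subseq_trans sub_y; rewrite /= !eqxx.
  move: dec_u; rewrite def_u /= => /and4P[/and4P[? ? ? _] /and3P[? ? _] _ _].
  by lia.
apply/hasP => -[y _ /andP[/= lt_dy]].
rewrite /splice -(cat1s N) catA => /subseq_catP[s1 [s2 []]].
have ge_d: size R <= d.
  have := mem_subseq sub1 (mem_head _ _); rewrite mem_cat inE.
  by case/orP=> [/splice_high/andP[] // | /eqP->]; rewrite leq_addl.
case/lastP: s2 => [|s2 z].
  rewrite cats0 => <- sub_s1 _.
  have: a \in L' ++ [:: N].
    by apply: (mem_subseq sub_s1); rewrite inE !mem_rcons !inE mem_rcons mem_head !orbT.
  have := splice_low aR; rewrite mem_cat inE.
  by move=> lt_a /orP[/splice_high | /eqP]; rewrite /N; lia.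
rewrite -rcons_cons -rcons_cat => /rcons_inj[_ y_z] _ sub_z.
have := splice_low (mem_subseq sub_z _ : z \in R); rewrite mem_rcons mem_head.
by move/(_ isT); lia.
Qed.

End Splice.

(** * Enumeration of the 132-avoiding words *)

Definition words132 (n : nat) : seq (seq nat) :=
  [seq w <- permutations (iota 0 n) | av132 w].

Lemma mem_words132 (n : nat) (w : seq nat) :
  (w \in words132 n) = perm_eq w (iota 0 n) && av132 w.
Proof. by rewrite mem_filter mem_permutations andbC. Qed.

Lemma words132P (n : nat) (w : seq nat) : w \in words132 n ->
  [/\ size w = n, perm_eq w (iota 0 (size w)) & av132 w].
Proof.
rewrite mem_words132 => /andP[perm_w ->].
by have := perm_size perm_w; rewrite size_iota => ->.
Qed.

(** Sorting both blocks and concatenating the low block before the high one sorts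
    the whole word, which pins down the set of letters of each block. *)
Lemma perm_iota_cat (s1 s2 : seq nat) :
  perm_eq (s1 ++ s2) (iota 0 (size s1 + size s2)) ->
  allrel gtn s1 s2 ->
  perm_eq s2 (iota 0 (size s2)) /\ perm_eq s1 (iota (size s2) (size s1)).
Proof.
move=> perm12 gt12.
suff /eqP: sort leq s2 ++ sort leq s1 = iota 0 (size s2) ++ iota (size s2) (size s1).
  rewrite eqseq_cat ?size_sort ?size_iota // => /andP[/eqP def2 /eqP def1].
  by split; rewrite -?def1 -?def2 perm_sym perm_sort.
rewrite -[X in _ ++ iota X _]add0n -iotaD.
apply: (sorted_eq leq_trans anti_leq); last 2 first.
- exact: iota_sorted.
- rewrite addnC; apply: perm_trans perm12.
  by rewrite perm_catC perm_cat // perm_sort.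
rewrite (sorted_pairwise leq_trans) pairwise_cat.
rewrite -!(sorted_pairwise leq_trans) !(sort_sorted leq_total) !andbT.
apply/allrelP => x y; rewrite !mem_sort => xs2 ys1.
by apply/ltnW/(allrelP gt12).
Qed.

Lemma splice_words132 (L R : seq nat) (k m : nat) :
  L \in words132 k -> R \in words132 m -> splice L R \in words132 (k + m).+1.
Proof.
move=> /words132P[<- permL avL] /words132P[<- permR avR].
rewrite mem_words132 av132_splice // avL avR !andbT /splice.
rewrite perm_sym -addn1 iotaD add0n addnC iotaD add0n /= -(addn0 (size R)) iotaDl.
rewrite addn0 perm_sym -cat1s perm_catCA perm_sym perm_catC perm_cat //=.
rewrite perm_catC perm_cat //.
  by rewrite perm_sym perm_map.
by rewrite perm_sym.
Qed.

(** A letter before the maximum n that is smaller than a letter after it would form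
    132 with n in between; so the letters before n are the largest ones. *)
Lemma words132_splice (n : nat) (w : seq nat) : w \in words132 n.+1 ->
  exists L R, [/\ w = splice L R, size L + size R = n,
                  L \in words132 (size L) & R \in words132 (size R)].
Proof.
move=> w_in; have [sz_w perm_w av_w] := words132P w_in.
rewrite sz_w in perm_w.
have n_in: n \in w by rewrite (perm_mem perm_w) mem_iota /= add0n.
case/splitPr: n_in w_in sz_w perm_w av_w => s R w_in sz_w perm_w av_w.
have uniq_w: uniq (s ++ n :: R) by rewrite (perm_uniq perm_w) iota_uniq.
have sz: size s + size R = n by move: sz_w; rewrite size_cat /= addnS => -[].
have perm_sR: perm_eq (s ++ R) (iota 0 n).
  move: perm_w; rewrite -addn1 iotaD add0n /= -cat1s perm_catCA perm_sym.
  by rewrite perm_catC perm_cat2l perm_sym.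
have lt_n x : x \in s ++ R -> x < n by rewrite (perm_mem perm_sR) mem_iota.
have gt_sR: allrel gtn s R.
  apply/allrelP => x y xs yR /=; rewrite ltnNge; apply: contraNN av_w => le_xy.
  apply/has_subseqP; exists [:: x; n; y].
    by apply: (@cat_subseq _ [:: x] [:: n; y]); rewrite /= ?eqxx sub1seq.
  have ne_xy: x != y.
    apply: contraTneq uniq_w => def_x; rewrite cat_uniq negb_and orbC.
    apply/orP; left; rewrite negb_and negbK; apply/orP; left.
    by apply/hasP; exists y; rewrite ?inE ?yR ?orbT //= -def_x.
  by rewrite /= ltn_neqAle ne_xy le_xy lt_n // mem_cat yR orbT.
rewrite -sz in perm_sR; have [permR perms] := perm_iota_cat perm_sR gt_sR.
have [L sL permL]: exists2 L, s = map (addn (size R)) L & perm_eq L (iota 0 (size s)).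
  exists (map (subn^~ (size R)) s).
    rewrite -map_comp -[LHS]map_id; apply/eq_in_map => x.
    by rewrite (perm_mem perms) mem_iota => /andP[le_x _] /=; rewrite subnKC.
  have -> : iota 0 (size s) = map (subn^~ (size R)) (iota (size R) (size s)).
    rewrite -[in RHS](addn0 (size R)) iotaDl -map_comp -[LHS]map_id.
    by apply: eq_map => x /=; rewrite ?addn0 addKn.
  exact: perm_map.
have szL: size L = size s by rewrite sL size_map.
have def_w: s ++ n :: R = splice L R by rewrite /splice -sL szL sz.
exists L, R; split=> //; first by rewrite szL.
  all: rewrite mem_words132 ?szL ?permL ?permR /=.
  all: by move: av_w; rewrite def_w av132_splice ?szL // => /andP[].
Qed.

(** The position of the maximum recovers the size of L. *)
Lemma splice_inj (L R L2 R2 : seq nat) :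
  perm_eq L (iota 0 (size L)) -> perm_eq L2 (iota 0 (size L2)) ->
  size L + size R = size L2 + size R2 ->
  splice L R = splice L2 R2 -> L = L2 /\ R = R2.
Proof.
have idx A B : perm_eq A (iota 0 (size A)) ->
    index (size A + size B) (splice A B) = size A.
  move=> permA; rewrite /splice index_cat size_map /= eqxx addn0.
  case: ifP => // /mapP[x]; rewrite (perm_mem permA) mem_iota => lt_x.
  by rewrite addnC => /addnI def_x; rewrite def_x ltnn andbF in lt_x.
move=> permL permL2 sz eq_w.
have szL: size L = size L2 by rewrite -(idx L R) // -(idx L2 R2) // sz eq_w.
have szR: size R = size R2 by lia.
move/eqP: eq_w; rewrite /splice eqseq_cat ?size_map // szR eqseq_cons.
by case/andP=> /eqP/(inj_map (@addnI _))-> /andP[_ /eqP ->].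
Qed.

Definition pairs132 (n k : nat) : seq (seq nat * seq nat) :=
  [seq (L, R) | L <- words132 k, R <- words132 (n - k)].

Lemma pairs132P (n k : nat) (p : seq nat * seq nat) :
  p \in pairs132 n k -> p.1 \in words132 k /\ p.2 \in words132 (n - k).
Proof. by case/allpairsP=> -[L R] [/= ? ? ->]. Qed.

Lemma words132_uniq (n : nat) : uniq (words132 n).
Proof. exact/filter_uniq/permutations_uniq. Qed.

Lemma words132S (n : nat) : perm_eq (words132 n.+1)
  [seq splice p.1 p.2 | k <- iota 0 n.+1, p <- pairs132 n k].
Proof.
apply: uniq_perm; first exact: words132_uniq.
  apply: allpairs_uniq_dep; first exact: iota_uniq.
    move=> k _; apply: allpairs_uniq; try exact: words132_uniq.
    by move=> [? ?] [? ?] _ _ /= [-> ->].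
  have tagP u : u \in [seq @Tagged nat k (fun=> (seq nat * seq nat)%type) p
                        | k <- iota 0 n.+1, p <- pairs132 n k] ->
     [/\ size (tagged u).1 = tag u, size (tagged u).1 + size (tagged u).2 = n
       & perm_eq (tagged u).1 (iota 0 (size (tagged u).1))].
    case/allpairsPdep => k [p [k_in /pairs132P[/words132P[sz1 perm1 _]]]].
    case/words132P => sz2 _ _ -> /=.
    by split=> //; move: k_in; rewrite mem_iota sz1 sz2; lia.
  move=> [k [L R]] [k2 [L2 R2]] /tagP[/= sz1 sz perm1] /tagP[/= sz2 sz' perm2] eq_w.
  have [eqL eqR] := splice_inj perm1 perm2 (etrans sz (esym sz')) eq_w.
  by rewrite -sz1 -sz2 eqL eqR.
move=> w; apply/idP/allpairsPdep => [/words132_splice|].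
  case=> L [R [-> sz L_in R_in]]; exists (size L), (L, R); split=> //.
    by rewrite mem_iota; lia.
  by apply/allpairsP; exists (L, R); rewrite /= -sz addKn.
case=> k [p [k_in /pairs132P[L_in R_in] ->]].
have -> : n.+1 = (k + (n - k)).+1 by move: k_in; rewrite mem_iota; lia.
exact: splice_words132.
Qed.

Lemma av132_nil : av132 [::].
Proof. by apply/has_subseqP => -[[|? ?]]. Qed.

Lemma words132_0 : words132 0 = [:: [::]].
Proof. by rewrite /words132 /= av132_nil. Qed.

(** The term k = n, where R is empty, is kept apart because D4-avoidance singles it
    out. *)
Lemma count_words132S (Q : pred (seq nat)) (n : nat) :
  count Q (words132 n.+1) =
    (\sum_(k < n) count (fun p => Q (splice p.1 p.2)) (pairs132 n k)
     + count (fun L => Q (splice L [::])) (words132 n))%N.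
Proof.
rewrite (seq.permP (words132S n)) count_flatten -map_comp sumnE big_map.
rewrite -[iota 0 n.+1]/(index_iota 0 n.+1) big_mkord big_ord_recr /=.
congr (_ + _)%N; first by apply: eq_bigr => k _; rewrite count_map.
rewrite count_map /pairs132 subnn words132_0 /=.
by elim: (words132 n) => //= L s ->.
Qed.

Lemma count_pairs132 (P1 P2 : pred (seq nat)) (n k : nat) :
  count (fun p => P1 p.1 && P2 p.2) (pairs132 n k) =
    count P1 (words132 k) * count P2 (words132 (n - k)).
Proof.
rewrite /pairs132; elim: (words132 k) => //= L s IHs.
rewrite count_cat IHs mulnDl count_map; congr (_ + _).
case PL: (P1 L).
  by rewrite mul1n; apply: eq_count => R; rewrite /= PL.
rewrite mul0n -(count_pred0 (words132 (n - k))).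
by apply: eq_count => R; rewrite /= PL.
Qed.

Lemma longest_dec_words132_gt0 (n : nat) (w : seq nat) :
  0 < n -> w \in words132 n -> 0 < longest_dec w.
Proof.
move=> n_gt0 /words132P[sz_w _ _]; apply: longest_dec_gt0.
by case: w sz_w n_gt0 => // <-.
Qed.

Lemma longest_dec_pairs132 (n k : nat) (p : seq nat * seq nat) : k < n ->
  p \in pairs132 n k ->
  longest_dec (splice p.1 p.2) = maxn 1 (longest_dec p.1) + longest_dec p.2
  /\ 0 < longest_dec p.2.
Proof.
move=> lt_kn /pairs132P[L_in R_in].
split; last by apply: longest_dec_words132_gt0 R_in; rewrite subn_gt0.
have [_ permL _] := words132P L_in; have [_ permR _] := words132P R_in.
exact: longest_dec_splice.
Qed.

Lemma longest_dec_splice_nil (n : nat) (L : seq nat) : L \in words132 n ->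
  longest_dec (splice L [::]) = maxn 1 (longest_dec L).
Proof.
by case/words132P=> _ permL _; rewrite longest_dec_splice // longest_dec_nil addn0.
Qed.

(** A nonempty R adds at least one to a term that is already at least one, so only
    the increasing word is counted. *)
Lemma count_longest_dec_le1 (n : nat) :
  count (fun w => longest_dec w <= 1) (words132 n) = 1.
Proof.
elim: n => [|n IHn]; first by rewrite words132_0 /= longest_dec_nil.
rewrite count_words132S big1 => [|k _].
  by rewrite -[RHS]IHn; apply: eq_in_count => L /longest_dec_splice_nil->; lia.
rewrite -[RHS](count_pred0 (pairs132 n k)); apply: eq_in_count => p p_in.
by have [-> ?] := longest_dec_pairs132 (ltn_ord k) p_in => /=; lia.
Qed.

(** Either R is empty, or both L and R are increasing, which is one word for each
    of the n sizes of L. *)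
Lemma count_longest_dec_le2 (n : nat) :
  count (fun w => longest_dec w <= 2) (words132 n) = 'C(n, 2).+1.
Proof.
elim: n => [|n IHn]; first by rewrite words132_0 /= longest_dec_nil.
rewrite count_words132S binS bin1 addnC -addSn -IHn; congr (_ + _).
  by apply: eq_in_count => L /longest_dec_splice_nil->; lia.
rewrite -[RHS]card_ord -sum1_card; apply: eq_bigr => k _.
transitivity (count (fun p => (longest_dec p.1 <= 1) && (longest_dec p.2 <= 1))
  (pairs132 n k)); last first.
  by rewrite (count_pairs132 (fun w => longest_dec w <= 1) (fun w => longest_dec w <= 1))
       !count_longest_dec_le1.
apply: eq_in_count => p p_in.
by have [/= -> ?] := longest_dec_pairs132 (ltn_ord k) p_in; lia.
Qed.

(** With ldec short for [longest_dec], ldec R is positive, so the condition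
    max(1, ldec L) + ldec R <= 3 is the union of the conditions Q1 and Q2
    below, whose intersection is a single pair. *)
Lemma count_avD4_pairs132 (n k : nat) : k < n ->
  count (fun p => avD4 (splice p.1 p.2)) (pairs132 n k) =
    'C(k, 2) + 'C(n - k, 2) + 1.
Proof.
move=> lt_kn.
pose Q1 p := (longest_dec p.1 <= 2) && (longest_dec p.2 <= 1).
pose Q2 p := (longest_dec p.1 <= 1) && (longest_dec p.2 <= 2).
have count1 : count Q1 (pairs132 n k) = 'C(k, 2).+1.
  by rewrite (count_pairs132 (fun w => longest_dec w <= 2) (fun w => longest_dec w <= 1))
       count_longest_dec_le1 count_longest_dec_le2 muln1.
have count2 : count Q2 (pairs132 n k) = 'C(n - k, 2).+1.
  by rewrite (count_pairs132 (fun w => longest_dec w <= 1) (fun w => longest_dec w <= 2))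
       count_longest_dec_le1 count_longest_dec_le2 mul1n.
have count12 : count (predI Q1 Q2) (pairs132 n k) = 1.
  transitivity (count (fun p => (longest_dec p.1 <= 1) && (longest_dec p.2 <= 1))
    (pairs132 n k)).
    by apply: eq_count => p; rewrite /= /Q1 /Q2; lia.
  by rewrite (count_pairs132 (fun w => longest_dec w <= 1) (fun w => longest_dec w <= 1))
       !count_longest_dec_le1.
have := count_predUI Q1 Q2 (pairs132 n k); rewrite count1 count2 count12.
suff -> : count (fun p => avD4 (splice p.1 p.2)) (pairs132 n k) =
          count (predU Q1 Q2) (pairs132 n k) by lia.
apply: eq_in_count => p p_in.
have [_ R_gt0] := longest_dec_pairs132 lt_kn p_in.
have [/words132P[_ permL avL] /words132P[_ permR avR]] := pairs132P p_in.
rewrite avD4_splice ?av132_splice ?avL ?avR // /= /Q1 /Q2.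
have -> : (p.2 == [::]) = false.
  by apply: contraTF R_gt0 => /eqP->; rewrite longest_dec_nil.
by lia.
Qed.

Lemma count_avD4 (n : nat) : count avD4 (words132 n.+1) =
  size (words132 n) + \sum_(k < n) ('C(k, 2) + 'C(n - k, 2) + 1).
Proof.
rewrite count_words132S addnC; congr (_ + _); last first.
  by apply: eq_bigr => k _; apply: count_avD4_pairs132.
rewrite -count_predT; apply: eq_in_count => L /words132P[_ permL avL].
by rewrite avD4_splice ?av132_splice ?avL ?av132_nil.
Qed.

Lemma size_words132S (n : nat) : size (words132 n.+1) =
  \sum_(k < n.+1) size (words132 k) * size (words132 (n - k)).
Proof.
rewrite -count_predT count_words132S big_ord_recr /= subnn words132_0 muln1.
rewrite count_predT; congr (_ + _); apply: eq_bigr => k _.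
by rewrite -!(count_predT (words132 _)) -count_pairs132.
Qed.

(** * The closed form *)

Section ClosedForm.
Import GRing.Theory Num.Theory.
Local Open Scope ring_scope.

Lemma catalanS (n : nat) :
  (n%:R + 2) * catalan n.+1 = 2 * (2 * n%:R + 1) * catalan n.
Proof.
have nz m : (m%:R + 1 : rat) != 0 by rewrite natr1 pnatr_eq0.
have E1 : (n%:R + 1) * 'C(2 * n.+1, n.+1)%:R
    = (2 * n%:R + 2) * 'C((2 * n).+1, n)%:R :> rat.
  have := mul_bin_diag (2 * n).+2 n; rewrite /=.
  have -> : (2 * n).+2 = (2 * n.+1)%N by lia.
  by move/(congr1 (fun m => m%:R : rat)); rewrite !natrM -!natr1 => <-; ring.
have E2 : (n%:R + 1) * 'C((2 * n).+1, n)%:R = (2 * n%:R + 1) * 'C(2 * n, n)%:R :> rat.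
  have := mul_bin_diag (2 * n).+1 n; rewrite /=.
  rewrite -(@bin_sub (2 * n).+1 n.+1) ?ltnS ?leq_pmull // mul2n subSS -addnn addnK.
  move/(congr1 (fun m => m%:R : rat)).
  by rewrite !natrM -!natr1 addnn -mul2n natrM => <-; ring.
have := nz n; have := nz n.+1; rewrite /catalan -(natr1 n.+1) -(natr1 n) => nz2 nz1.
apply: (mulfI nz1); apply: (mulfI nz1).
transitivity ((n%:R + 1) * ((n%:R + 1) * 'C(2 * n.+1, n.+1)%:R) : rat).
  by field.
rewrite E1 mulrCA E2; field.
exact: nz1.
Qed.

(** Convolution recurrence of the Catalan numbers.  With cb the central binomial
    coefficients, the summand is the difference T (k + 1) - T k of Gosper's
    antidifference T, and the boundary values of T add up to the next Catalan
    number. *)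
Lemma sum_catalan (n : nat) :
  \sum_(k < n.+1) catalan k * catalan (n - k) = catalan n.+1.
Proof.
pose cb k : rat := (k%:R + 1) * catalan k.
pose T k : rat := cb k * cb (n.+1 - k)%N * (2 * k%:R - n%:R - 1)
  / (2 * (n%:R + 1) * (n%:R + 2)).
have nz m : (m%:R + 1 : rat) != 0 by rewrite natr1 pnatr_eq0.
have cbS m : cb m.+1 = 2 * (2 * m%:R + 1) * catalan m.
  by rewrite -catalanS /cb -natr1; ring.
transitivity (\sum_(0 <= k < n.+1) (T k.+1 - T k)).
  rewrite big_mkord; apply: eq_bigr => k _; have le_kn : (k <= n)%N by rewrite -ltnS.
  rewrite /T subSS subSn // !cbS /cb -natr1.
  have -> : n%:R = k%:R + (n - k)%:R :> rat by rewrite -natrD subnKC.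
  have nz1 := nz (k + (n - k))%N; have := nz (k + (n - k)).+1%N.
  rewrite -(natr1 (k + _)) !natrD in nz1 * => nz2.
  field.
  by rewrite nz1 andbT -[2]/(1 + 1) addrA.
rewrite telescope_sumr // /T subnn subn0 cbS /cb.
have := nz n.+1; rewrite -(natr1 n) => nz2; have nz1 := nz n.
rewrite -addrA -[1 + 1]/(2 : rat) in nz2.
have cat0 : catalan 0 = 1 by rewrite /catalan muln0 bin0.
apply: (mulfI nz2); rewrite catalanS cat0; field.
by rewrite nz2.
Qed.

Lemma size_words132 (n : nat) : (size (words132 n))%:R = catalan n.
Proof.
elim/ltn_ind: n => -[|n] IHn; first by rewrite words132_0.
rewrite size_words132S natr_sum -sum_catalan; apply: eq_bigr => k _.
by rewrite natrM !IHn ?ltnS ?leq_subr // -ltnS.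
Qed.

Lemma bin2_rat (n : nat) : 'C(n, 2)%:R = n%:R * (n%:R - 1) / 2 :> rat.
Proof.
elim: n => [|n IHn]; first by rewrite bin0n mulr0n !mul0r.
by rewrite binS bin1 natrD IHn -natr1; field.
Qed.

Lemma sum_bin2_rat (n : nat) :
  (\sum_(k < n) ('C(k, 2) + 'C(n - k, 2) + 1))%:R
    = n%:R * (2 * n%:R ^+ 2 - 3 * n%:R + 7) / 6 :> rat.
Proof.
(* Induction on the upper bound m of the sum needs n fixed in the summand. *)
have gen m : (m <= n)%N -> (\sum_(k < m) ('C(k, 2) + 'C(n - k, 2) + 1))%:R =
    m%:R * (n%:R ^+ 2 - n%:R) / 2 - n%:R * m%:R * (m%:R - 1) / 2
    + m%:R * (m%:R - 1) * (2 * m%:R - 1) / 6 + m%:R :> rat.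
  elim: m => [|m IHm] lt_mn; first by rewrite big_ord0; field.
  rewrite big_ord_recr natrD IHm 1?ltnW // !natrD !bin2_rat -natr1.
  by rewrite natrB 1?ltnW //; field.
by rewrite gen //; field.
Qed.

Lemma count_avD4_rat (n : nat) : (0 < n)%N ->
  (count avD4 (words132 n))%:R = catalan (n - 1)
     + (n%:R - 1) * (2 * n%:R ^+ 2 - 7 * n%:R + 12) / 6 :> rat.
Proof.
case: n => // n _; rewrite count_avD4 natrD size_words132 sum_bin2_rat subSS subn0.
by rewrite -natr1; congr (_ + _); field.
Qed.

End ClosedForm.

(** * From permutations to words *)

Definition word n (s : 'S_n) : seq nat := [seq val (s j) | j <- enum 'I_n].

Definition subword m n (s : 'S_n) (i : {ffun 'I_m -> 'I_n}) : seq nat :=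
  [seq val (s (i k)) | k <- enum 'I_m].

Section Words.
Variable n : nat.
Implicit Types (s : 'S_n) (j r : 'I_n).

Lemma size_word s : size (word s) = n.
Proof. by rewrite size_map size_enum_ord. Qed.

Lemma nth_word s j : nth 0 (word s) j = s j.
Proof. by rewrite (nth_map j) ?size_enum_ord // nth_ord_enum. Qed.

Lemma word_uniq s : uniq (word s).
Proof. by rewrite map_inj_uniq ?enum_uniq // => j k /val_inj/perm_inj. Qed.

Lemma word_inj : injective (@word n).
Proof.
move=> s1 s2 eq_w; apply/permP => j.
by apply: val_inj; rewrite /= -!nth_word eq_w.
Qed.

Lemma perm_word s : perm_eq (word s) (iota 0 n).
Proof.
have sub_w: {subset word s <= iota 0 n}.
  by move=> _ /mapP[j _ ->]; rewrite mem_iota ltn_ord.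
apply: uniq_perm; rewrite ?word_uniq ?iota_uniq //.
by apply: (uniq_min_size (word_uniq s) sub_w _).2; rewrite size_word size_iota.
Qed.

(** Injectivity and equality of the cardinals n! make this a bijection. *)
Lemma perm_words : perm_eq [seq word s | s <- enum 'S_n] (permutations (iota 0 n)).
Proof.
have uniq_ws: uniq [seq word s | s <- enum 'S_n].
  by rewrite map_inj_uniq ?enum_uniq //; apply: word_inj.
apply: uniq_perm; rewrite ?permutations_uniq //.
apply: (uniq_min_size uniq_ws _ _).2.
  by move=> _ /mapP[s _ ->]; rewrite mem_permutations perm_word.
rewrite size_permutations ?iota_uniq // size_iota size_map -cardE.
by rewrite card_Sn.
Qed.

Lemma word_split s j :
  word s = take j (word s) ++ val (s j) :: drop j.+1 (word s).
Proof. by rewrite -[val (s j)]nth_word -drop_nth ?cat_take_drop // size_word. Qed.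

Lemma mem_take_word s j (y : nat) :
  reflect (exists2 r : 'I_n, r < j & y = s r) (y \in take j (word s)).
Proof.
have sz_take : size (take j (word s)) = j by rewrite size_takel // size_word ltnW.
apply: (iffP (nthP 0)) => [[r] | [r lt_rj ->]].
  rewrite sz_take => lt_rj.
  rewrite nth_take // => <-; have lt_rn := ltn_trans lt_rj (ltn_ord j).
  by exists (Ordinal lt_rn); rewrite // -nth_word.
by exists r; rewrite ?sz_take ?nth_take ?nth_word.
Qed.

Lemma mem_drop_word s j (y : nat) :
  reflect (exists2 r : 'I_n, j < r & y = s r) (y \in drop j.+1 (word s)).
Proof.
apply: (iffP (nthP 0)) => [[r] | [r lt_jr ->]].
  rewrite size_drop size_word nth_drop => lt_r <-.
  have lt_rn: j.+1 + r < n by rewrite -ltn_subRL.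
  exists (Ordinal lt_rn); last by rewrite -nth_word.
  by rewrite /= addSn ltnS leq_addr.
exists (r - j.+1); first by rewrite size_drop size_word ltn_sub2r //
                            (leq_ltn_trans lt_jr).
by rewrite nth_drop subnKC // nth_word.
Qed.

(** As the letters of a word are distinct, a subsequence has only one embedding;
    so the letters extending it to the left are those before its first position.
    *)
Lemma subseq_cons_word s j (t : seq nat) (y : nat) :
  subseq (val (s j) :: t) (word s) ->
  subseq (y :: val (s j) :: t) (word s) = (y \in take j (word s)).
Proof.
have uniq_w := word_uniq s; rewrite (word_split s j) in uniq_w *.
rewrite -[val (s j) :: t]cat0s uniq_subseq_pivot // => /andP[_ sub_t].
rewrite -cat1s uniq_subseq_pivot // sub_t andbT sub1seq.
by rewrite -word_split.
Qed.

Lemma subseq_rcons_word s j (t : seq nat) (y : nat) :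
  subseq (rcons t (val (s j))) (word s) ->
  subseq (rcons (rcons t (val (s j))) y) (word s) = (y \in drop j.+1 (word s)).
Proof.
have uniq_w := word_uniq s; rewrite (word_split s j) in uniq_w *.
rewrite -cats1 uniq_subseq_pivot // => /andP[sub_t _].
by rewrite -cats1 -catA uniq_subseq_pivot // sub_t sub1seq -word_split.
Qed.

Definition increasing m (i : {ffun 'I_m -> 'I_n}) : bool :=
  [forall j : 'I_m, forall k : 'I_m, (j < k) ==> (i j < i k)].

(** Both the positions i and the positions of the word belonging to the range of i
    are listed in increasing order, so they form the same sequence. *)
Lemma subseq_subword m s (i : {ffun 'I_m -> 'I_n}) :
  increasing i -> subseq (subword s i) (word s).
Proof.
move/forallP => inc_i.
have -> : subword s i = [seq val (s j) | j <- [seq i k | k <- enum 'I_m]].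
  by rewrite -map_comp.
apply: map_subseq; apply/subseq_uniqP; first exact: enum_uniq.
have lt_tr : transitive (relpre (@nat_of_ord n) ltn).
  by move=> x y z /=; apply: ltn_trans.
have sorted_enum p : sorted (relpre (@nat_of_ord p) ltn) (enum 'I_p).
  by rewrite -sorted_map val_enum_ord iota_ltn_sorted.
apply: (irr_sorted_eq lt_tr) => [x||| x] /=.
- exact: ltnn.
- rewrite sorted_map; apply: sub_sorted (sorted_enum m) => j k lt_jk /=.
  by have /forallP/(_ k)/implyP := inc_i j; apply.
- exact: sorted_filter.
- by rewrite mem_filter mem_enum andbT.
Qed.

Lemma subseq_wordP s (t : seq nat) : subseq t (word s) ->
  exists2 i : {ffun 'I_(size t) -> 'I_n}, increasing i & t = subword s i.
Proof.
case/subseqP=> b sz_b def_t; set u := mask b (enum 'I_n).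
have t_u : t = [seq val (s j) | j <- u] by rewrite map_mask.
have sz_u : size u == size t by rewrite t_u size_map.
have sorted_u : sorted (relpre (@nat_of_ord n) ltn) u.
  apply: (subseq_sorted _ (mask_subseq _ _)).
    by move=> x y z /=; apply: ltn_trans.
  by rewrite -sorted_map val_enum_ord iota_ltn_sorted.
exists [ffun k => tnth (Tuple sz_u) k].
  apply/forallP => j; apply/forallP => k; apply/implyP => lt_jk; rewrite !ffunE.
  have x0 := tnth (Tuple sz_u) j.
  rewrite !(tnth_nth x0) /=.
  apply: (sorted_ltn_nth _ x0 sorted_u) => //; rewrite ?inE ?(eqP sz_u) //.
  by move=> x y z /=; apply: ltn_trans.
have eq_k : (fun k => val (s ([ffun k => tnth (Tuple sz_u) k] k)))
    =1 (fun j => val (s j)) \o tnth (Tuple sz_u) by move=> k; rewrite /= ffunE.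
by rewrite /subword (eq_map eq_k) map_comp map_tnth_enum.
Qed.

(** Subsequences of the word correspond to increasing choices of positions. *)
Lemma has_subseq_word m s (P : pred (seq nat)) :
  (forall t, P t -> size t = m) ->
  has_subseq P (word s) =
    [exists i : {ffun 'I_m -> 'I_n}, increasing i && P (subword s i)].
Proof.
move=> sizeP; apply/has_subseqP/existsP => [[t /subseq_wordP[i inc_i def_t] Pt] | [i]].
  have sz_t := sizeP t Pt; rewrite {}def_t in Pt; subst m.
  by exists i; rewrite inc_i.
by case/andP=> inc_i Pi; exists (subword s i) => //; apply: subseq_subword.
Qed.

Lemma forall_ordS m (P : pred 'I_m.+1) :
  [forall k, P k] = P ord0 && [forall k : 'I_m, P (lift ord0 k)].
Proof.
apply/forallP/andP => [allP | [P0 /forallP allP] k].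
  by split; last apply/forallP => k; apply: allP.
by have [k' ->|->] := unliftP ord0 k.
Qed.

Lemma forall_ord0 (P : pred 'I_0) : [forall k, P k].
Proof. by apply/forallP => -[]. Qed.

Lemma mesh_occ132 s (i : {ffun 'I_3 -> 'I_n}) :
  mesh_occ p132 s i = increasing i && is132 (subword s i).
Proof.
rewrite /mesh_occ /subword; congr (_ && _).
have -> : [forall c in mesh_shading p132, ~~ [exists r : 'I_n,
    (nth 0 (pos_lines i) c.1 < r.+1 < nth 0 (pos_lines i) c.1.+1)
    && (nth 0 (val_lines s i) c.2 < (s r).+1 < nth 0 (val_lines s i) c.2.+1)]].
  by apply/forall_inP => c; rewrite inE.
rewrite andbT /=; have := perm132_one_line.
rewrite !enum_ordSl enum_ord0 /= => -[p0 p1 p2].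
rewrite !forall_ordS !forall_ord0 p0 p1 p2 /=; lia.
Qed.

(** For a decreasing quadruple the sorted values are the reversed letters, so the
    corner (0, 0) is bounded by the first position and the last letter, and the
    corner (4, 4) by the last position and the first letter. *)
Lemma mesh_occD4 s (i : {ffun 'I_4 -> 'I_n}) :
  mesh_occ D4 s i = increasing i && occD4 (word s) (subword s i).
Proof.
rewrite /mesh_occ; case inc_i: (increasing i); rewrite /increasing in inc_i;
  rewrite inc_i //.
have sub_i := subseq_subword s inc_i.
have def_t : subword s i =
   [:: val (s (i ord0)); val (s (i (lift ord0 ord0)));
       val (s (i (lift ord0 (lift ord0 ord0)))); val (s (i ord_max))].
  rewrite /subword !enum_ordSl enum_ord0 /=.
  by do 4!congr (_ :: _); congr (val (s (i _))); apply: val_inj.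
have -> : [forall j : 'I_4, forall k : 'I_4,
     (s (i j) < s (i k)) == (mesh_perm D4 j < mesh_perm D4 k)]
   = pairwise gtn (subword s i).
  rewrite /subword; have := perm4321_one_line.
  rewrite !enum_ordSl enum_ord0 /= => -[p0 p1 p2 p3].
  by rewrite !forall_ordS !forall_ord0 p0 p1 p2 p3 /=; lia.
have -> (F : 'I_5 * 'I_5 -> bool) : [forall c in mesh_shading D4, ~~ F c]
    = ~~ F (ord0, ord0) && ~~ F (ord_max, ord_max).
  apply/forall_inP/andP => [allF | [F0 F4] c].
    by split; apply: allF; rewrite !inE eqxx ?orbT.
  by rewrite !inE => /orP[] /eqP->.
rewrite andTb /occD4; case dec_t: (pairwise gtn (subword s i)); last by rewrite andbF.
have -> : size (subword s i) = 4 by rewrite def_t.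
have def_pos : pos_lines i = [:: 0; (i ord0).+1; (i (lift ord0 ord0)).+1;
    (i (lift ord0 (lift ord0 ord0))).+1; (i ord_max).+1; n.+1].
  rewrite /pos_lines !enum_ordSl enum_ord0 /=; do 5!congr (_ :: _).
  by congr (nat_of_ord (i _)).+1; apply: val_inj.
have def_val : val_lines s i = [:: 0; (s (i ord_max)).+1;
    (s (i (lift ord0 (lift ord0 ord0)))).+1;
    (s (i (lift ord0 ord0))).+1; (s (i ord0)).+1; n.+1].
  rewrite /val_lines (map_comp S) -/(subword s i) def_t.
  set t := map S _; have -> : sort leq t = rev t.
    apply: (sorted_eq leq_trans anti_leq (sort_sorted leq_total _)).
      by move: dec_t; rewrite def_t /t /rev /=; lia.
    by rewrite perm_sort perm_sym perm_rev.
  by [].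
have start_t y : subseq (y :: subword s i) (word s) = (y \in take (i ord0) (word s)).
  by rewrite def_t subseq_cons_word // -def_t.
have end_t y : subseq (rcons (subword s i) y) (word s)
    = (y \in drop (i ord_max).+1 (word s)).
  rewrite def_t; apply: (@subseq_rcons_word s (i ord_max) [:: _; _; _]).
  by rewrite [rcons _ _]/= -def_t.
have -> : last 0 (subword s i) = s (i ord_max) by rewrite def_t.
have -> : head 0 (subword s i) = s (i ord0) by rewrite def_t.
have word_s r : val (s r) \in word s.
  by apply: (map_f (fun j => val (s j))); rewrite mem_enum.
rewrite def_pos def_val /=; congr (~~ _ && ~~ _); apply/existsP/hasP.
- case=> r /andP[lt_r lt_sr]; exists (val (s r)) => //.
  by apply/andP; split=> //; rewrite start_t; apply/mem_take_word; exists r.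
- case=> y _ /andP[lt_y]; rewrite start_t => /mem_take_word[r lt_r def_y].
  by exists r; rewrite !ltnS lt_r -def_y.
- case=> r /andP[/andP[lt_r _] /andP[lt_sr _]]; exists (val (s r)) => //.
  by apply/andP; split=> //; rewrite end_t; apply/mem_drop_word; exists r.
case=> y _ /andP[lt_y]; rewrite end_t => /mem_drop_word[r lt_r def_y].
by exists r; rewrite !ltnS lt_r -def_y lt_y def_y !ltn_ord.
Qed.

Lemma mesh_avoids132 s : mesh_avoids p132 s = av132 (word s).
Proof.
rewrite /mesh_avoids /av132 (@has_subseq_word 3); last by case=> [|? [|? [|? []]]].
by congr (~~ _); apply: eq_existsb => i; apply: mesh_occ132.
Qed.

Lemma mesh_avoidsD4 s : mesh_avoids D4 s = avD4 (word s).
Proof.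
rewrite /mesh_avoids /avD4 (@has_subseq_word 4); last by move=> t /and4P[/eqP].
by congr (~~ _); apply: eq_existsb => i; apply: mesh_occD4.
Qed.

Lemma card_avoiders2 : #|avoiders2 n p132 D4| = count avD4 (words132 n).
Proof.
rewrite count_filter -(seq.permP perm_words) count_map.
rewrite -sum1_card -sum1_count big_enum_cond; apply: eq_bigl => s.
by rewrite !inE /= mesh_avoids132 mesh_avoidsD4 andbC.
Qed.

End Words.

Theorem theorem4p6 (n : nat) (hn : 1 <= n) :
  (#|avoiders2 n p132 D4|%:R =
     catalan (n - 1)
     + (n%:R - 1) * (2 * n%:R ^+ 2 - 7 * n%:R + 12) / 6 :> rat)%R.
Proof. by rewrite card_avoiders2 count_avD4_rat. Qed.
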